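(* Let $D:f=0$ be a free hypersurface of degree $d>1$ in $\mathbb{P}^n$. Consider an affine part of it, namely the affine hypersurface $$X_H=D\setminus H\subset\mathbb{P}^n\setminus H\simeq\mathbb{C}^n,$$ for a hyperplane $H\subset\mathbb{P}^n$ which is not an irreducible component of $D$. Then the affine hypersurface $X_H$ is $A$-free.
   Context: All hypersurfaces are complex and reduced. $S=\mathbb{C}[x_0,\ldots,x_n]$ and $f\in S$ is homogeneous, reduced, of degree $d$, with partial derivatives $f_0,\ldots,f_n$. The hypersurface $D:f=0$ is called free if the graded $S$-module $AR(f)=\{(a_0,\ldots,a_n)\in S^{n+1}: a_0f_0+\cdots+a_nf_n=0\}$ is free. The identification $\mathbb{P}^n\setminus H\simeq\mathbb{C}^n$ is the usual one: choosing linear homogeneous coordinates in which $H$ is $x_0=0$, $X_H$ is defined in $\mathbb{C}^n$ by $f(1,x_1,\ldots,x_n)=0$. With $R=\mathbb{C}[x_1,\ldots,x_n]$, a reduced affine hypersurface $X:g=0$ in $\mathbb{C}^n$ ($g\in R$) is called $A$-free if the $R$-module $Der(X)=\{\partial=\sum_{j=1}^n\alpha_j\,\partial/\partial x_j : \alpha_j\in R,\ \partial g\in (g)\}$ is free. *)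

(* Defs.v *)
From mathcomp Require Import all_boot all_order all_algebra.
From mathcomp Require Export mpoly.
From mathcomp Require Export complex.
From mathcomp Require Export reals.

Set Implicit Arguments.
Unset Strict Implicit.
Unset Printing Implicit Defensive.

Import GRing.Theory.
Local Open Scope ring_scope.

(* The basis is a family indexed by an arbitrary type, finite or not; linear
   combinations are sums over duplicate-free finite lists of indices. *)
Definition is_basis (A : pzRingType) (V : lmodType A) (M : V -> Prop)
    (I : eqType) (b : I -> V) : Prop :=
  [/\ forall i, M (b i),
      forall v, M v -> exists (s : seq I) (c : I -> A),
        uniq s /\ v = \sum_(i <- s) c i *: b i
    & forall (s : seq I) (c : I -> A), uniq s ->
        \sum_(i <- s) c i *: b i = 0 -> forall i, i \in s -> c i = 0].

Definition free_module (A : pzRingType) (V : lmodType A) (M : V -> Prop) : Prop :=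
  exists (I : eqType) (b : I -> V), is_basis M b.

Section Hypersurfaces.
Variable C : fieldType.

Definition mdivides (n : nat) (p q : {mpoly C[n]}) : Prop :=
  exists r : {mpoly C[n]}, q = r * p.

(* This excludes p = 0. *)
Definition reduced (n : nat) (p : {mpoly C[n]}) : Prop :=
  forall q : {mpoly C[n]}, mdivides (q ^+ 2) p -> q \is a GRing.unit.

Definition irreducible_mpoly (n : nat) (p : {mpoly C[n]}) : Prop :=
  [/\ p != 0, p \isn't a GRing.unit
    & forall q r : {mpoly C[n]}, p = q * r ->
        q \is a GRing.unit \/ r \is a GRing.unit].

(* The irreducible components of f = 0 are the hypersurfaces h = 0 for h an
   irreducible factor of f. *)
Definition irreducible_component (n : nat) (f h : {mpoly C[n]}) : Prop :=
  irreducible_mpoly h /\ mdivides h f.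

Definition AR (n : nat) (f : {mpoly C[n]}) (a : 'rV[{mpoly C[n]}]_n) : Prop :=
  \sum_(i < n) a 0 i * f^`M(i) = 0.

Definition free_hypersurface (n : nat) (f : {mpoly C[n]}) : Prop :=
  free_module (AR f).

(* The derivation \sum_j alpha_j d/dx_j is encoded by the row vector alpha. *)
Definition Der (n : nat) (g : {mpoly C[n]}) (alpha : 'rV[{mpoly C[n]}]_n) : Prop :=
  mdivides g (\sum_(j < n) alpha 0 j * g^`M(j)).

Definition A_free (n : nat) (g : {mpoly C[n]}) : Prop :=
  reduced g /\ free_module (Der g).

(* The polynomial p(M y): the expression of p in the linear coordinates y
   given by x = M y. *)
Definition change_coords (n : nat) (M : 'M[C]_n) (p : {mpoly C[n]}) :
    {mpoly C[n]} :=
  p \mPo [tuple \sum_(j < n) M i j *: 'X_j | i < n].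

(* p(1, x_1, ..., x_n), where x_1, ..., x_n are the variables
   'X_0, ..., 'X_(n-1) of {mpoly C[n]}. *)
Definition dehomogenize (n : nat) (p : {mpoly C[n.+1]}) : {mpoly C[n]} :=
  p \mPo (cons_tuple (1 : {mpoly C[n]}) [tuple 'X_i | i < n]).

(* The linear coordinates y given by x = M y are such that the hyperplane
   l = 0 is y_0 = 0. *)
Definition adapted_coords (n : nat) (l : {mpoly C[n.+1]}) (M : 'M[C]_n.+1) : Prop :=
  M \in unitmx /\
  exists2 c : C, c != 0 & change_coords M l = c *: 'X_ord0.

End Hypersurfaces.

(* Main.v *)
(* Idea. After a linear change of coordinates H is x_0 = 0. Put g = f(1, x). By
   Euler's formula, b |-> (b_j - b_0 x_j)_{j >= 1} identifies the syzygies
   of (f_0, ..., f_n)(1, x) over C[x_1, ..., x_n] with Der(g).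
   Homogenizing, every such syzygy is the specialization at x_0 = 1 of an element
   of AR(f), and an element of AR(f) vanishing at x_0 = 1 is x_0 - 1 times
   an element of AR(f). So Der(g) is AR(f) tensored with
   C[x_0, ..., x_n] / (x_0 - 1), and any basis of AR(f), homogeneous or not,
   specializes to a basis of Der(g). *)

From HB Require Import structures.
Require Import Defs.
From mathcomp Require Import all_boot all_order all_algebra.
From mathcomp Require Import mpoly complex reals.

Set Implicit Arguments.
Unset Strict Implicit.
Unset Printing Implicit Defensive.

Import GRing.Theory Num.Theory.
Local Open Scope ring_scope.

(** * Substitution, partial derivatives and homogeneity *)

HB.instance Definition _ (C : fieldType) (n : nat) (M : 'M[C]_n) :=
  GRing.LRMorphism.copy (change_coords M)
    (comp_mpoly [tuple \sum_(j < n) M i j *: 'X_j | i < n]).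

HB.instance Definition _ (C : fieldType) (n : nat) :=
  GRing.LRMorphism.copy (@dehomogenize C n)
    (comp_mpoly (cons_tuple (1 : {mpoly C[n]}) [tuple 'X_i | i < n])).

(** Reduces identities about substitutions and derivations to constants and variables, with no
    computation on monomials. *)
Lemma mpoly_ring_ind (n : nat) (A : comNzRingType) (P : {mpoly A[n]} -> Prop) :
    (forall c, P c%:MP) -> (forall i, P 'X_i) ->
    (forall p q, P p -> P q -> P (p + q)) ->
    (forall p q, P p -> P q -> P (p * q)) ->
  forall p, P p.
Proof.
move=> PC PX PD PM; elim/mpolyind => [|c m p _ _ IHp].
  by rewrite -mpolyC0; apply: PC.
apply: (PD) => //; rewrite -mul_mpolyC; apply: (PM) => //.
rewrite mpolyXE_id; apply: (big_ind P) => // [|i _]; first exact: PC 1.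
by elim: (m i) => [|k IHk]; [exact: PC 1 | rewrite exprS; apply: PM].
Qed.

Lemma comp_mpolyXi (A : comNzRingType) (n k : nat) (lq : n.-tuple {mpoly A[k]})
    (i : 'I_n) :
  'X_i \mPo lq = tnth lq i.
Proof. by rewrite comp_mpolyXU -tnth_nth. Qed.

Lemma comp_mpolyA (A : comNzRingType) (n k h : nat)
    (lq : n.-tuple {mpoly A[k]}) (lr : k.-tuple {mpoly A[h]}) p :
  (p \mPo lq) \mPo lr = p \mPo [tuple tnth lq i \mPo lr | i < n].
Proof.
elim/mpoly_ring_ind: p => [c|i|p q IHp IHq|p q IHp IHq].
- by rewrite !comp_mpolyC.
- by rewrite !comp_mpolyXi tnth_mktuple.
- by rewrite !raddfD /= IHp IHq.
- by rewrite !rmorphM /= IHp IHq.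
Qed.

Lemma mderivXU (A : comNzRingType) (n : nat) (i j : 'I_n) :
  'X_i^`M(j) = (i == j)%:R :> {mpoly A[n]}.
Proof.
rewrite mderivX mnm1E; case: eqP => [->|_]; last by rewrite scale0r.
by rewrite scale1r -{1}[U_(j)%MM]add0m addmK mpolyX0.
Qed.

Lemma mderiv_comp (A : comNzRingType) (n k : nat) (lq : n.-tuple {mpoly A[k]})
    (j : 'I_k) (p : {mpoly A[n]}) :
  (p \mPo lq)^`M(j) = \sum_(i < n) (p^`M(i) \mPo lq) * (tnth lq i)^`M(j).
Proof.
elim/mpoly_ring_ind: p => [c|i|p q IHp IHq|p q IHp IHq].
- rewrite comp_mpolyC mderivC big1 // => i _.
  by rewrite mderivC raddf0 mul0r.
- rewrite comp_mpolyXi (bigD1 i) //= big1 => [|i' ne_i'i].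
    by rewrite mderivXU eqxx comp_mpoly1 mul1r addr0.
  by rewrite mderivXU eq_sym (negbTE ne_i'i) comp_mpoly0 mul0r.
- rewrite raddfD mderivD IHp IHq -big_split; apply: eq_bigr => i _ /=.
  by rewrite mderivD raddfD mulrDl.
- rewrite rmorphM mderivM IHp IHq mulr_suml mulr_sumr -big_split.
  apply: eq_bigr => i _ /=; rewrite mderivM raddfD /= !rmorphM /= mulrDl.
  by rewrite mulrAC mulrA.
Qed.

(** The operator ['X_i * d/dX_i] multiplies ['X_[m]] by [m i], and these exponents add up to [d] on
    each monomial of [p]. *)
Lemma euler_dhomog (A : comNzRingType) (n d : nat) (p : {mpoly A[n]}) :
  p \is d.-homog -> \sum_(i < n) 'X_i * p^`M(i) = p *+ d.
Proof.
move=> p_hom.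
transitivity (\sum_(m <- msupp p) p@_m *: 'X_[m] *+ d); last first.
  by rewrite sumrMnl -mpolyE.
rewrite {1}(mpolyE p).
under eq_bigr do rewrite raddf_sum mulr_sumr.
rewrite exchange_big big_seq [RHS]big_seq; apply: eq_bigr => m m_p /=.
rewrite -(dhomog_mf p_hom m_p) /= mdegE -sumrMnr; apply: eq_bigr => i _.
rewrite mderivZ mderivX scalerA -scalerAr mulr_natr scalerMnl.
case: (posnP (m i)) => [->|mi_gt0]; first by rewrite !mulr0n !scale0r.
by rewrite -mpolyXD addmC submK // lep1mP -lt0n.
Qed.

Lemma dhomog_X1 (A : nzRingType) (n : nat) (i : 'I_n) :
  ('X_i : {mpoly A[n]}) \is 1.-homog.
Proof. by rewrite dhomogX /= mdeg1. Qed.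

(** For [d = 0] the truncated degree [d.-1] is harmless: the derivative is then zero, which is
    homogeneous of every degree. *)
Lemma mderiv_dhomog (A : comNzRingType) (n d : nat) (i : 'I_n)
    (p : {mpoly A[n]}) :
  p \is d.-homog -> p^`M(i) \is d.-1.-homog.
Proof.
move=> p_hom; rewrite (mpolyE p) raddf_sum big_seq.
apply: rpred_sum => m m_p /=; rewrite mderivZ mderivX scalerA.
have [->|mi_n0] := eqVneq (m i) 0; first by rewrite mulr0 scale0r rpred0.
apply: rpredZ; rewrite dhomogX -(dhomog_mf p_hom m_p) /=.
have /submK {2}<- : (U_(i) <= m)%MM by rewrite lep1mP.
by rewrite mdegD mdeg1 addn1.
Qed.

Lemma comp_dhomog (A : comNzRingType) (n k d : nat)
    (lq : n.-tuple {mpoly A[k]}) (p : {mpoly A[n]}) :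
  (forall i, tnth lq i \is 1.-homog) -> p \is d.-homog ->
  p \mPo lq \is d.-homog.
Proof.
move=> lq_hom p_hom; rewrite comp_mpolyEX big_seq.
apply: rpred_sum => m m_p; apply: rpredZ.
rewrite comp_mpolyX -(dhomog_mf p_hom m_p) /= mdegE.
apply: (big_ind2 (fun (q : {mpoly A[k]}) e => q \is e.-homog)).
- exact: dhomog1.
- by move=> q1 e1 q2 e2 h1 h2; apply: dhomogM.
- by move=> i _; have := dhomogMn (m i) (lq_hom i); rewrite mul1n.
Qed.

(** * Specializing the first variable, dehomogenization and homogenization *)

(** Every [p] is [p(c, x)] plus a multiple of ['X_ord0 - c], by induction on the ring generators.
    The value [c = 1] serves dehomogenization, and [c = 0] the primality of ['X_ord0]. *)
Lemma mpoly_first_factor (C : fieldType) (n : nat) (c : C)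
    (p : {mpoly C[n.+1]}) :
  p \mPo (cons_tuple c%:MP_[n] [tuple 'X_i | i < n]) = 0 ->
  exists q, p = ('X_ord0 - c%:MP) * q.
Proof.
pose lift_vars (r : {mpoly C[n]}) : {mpoly C[n.+1]} :=
  r \mPo [tuple 'X_(lift ord0 i) | i < n].
set lq := cons_tuple _ _ => p_at_c.
suff [q ->] : exists q, p = lift_vars (p \mPo lq) + ('X_ord0 - c%:MP) * q.
  by exists q; rewrite p_at_c /lift_vars comp_mpoly0 add0r.
elim/mpoly_ring_ind: p {p_at_c}
  => [a|i|p1 p2 [q1 e1] [q2 e2]|p1 p2 [q1 e1] [q2 e2]].
- by exists 0; rewrite /lift_vars !comp_mpolyC mulr0 addr0.
- rewrite comp_mpolyXi; case: (unliftP ord0 i) => [j ->|->].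
    exists 0; rewrite tnthS tnth_mktuple /lift_vars comp_mpolyXi tnth_mktuple.
    by rewrite mulr0 addr0.
  by exists 1; rewrite tnth0 /lift_vars comp_mpolyC mulr1 addrCA subrr addr0.
- exists (q1 + q2); rewrite {1}e1 {1}e2 /lift_vars !raddfD /= mulrDr.
  by rewrite addrACA.
- exists (lift_vars (p1 \mPo lq) * q2 + q1 * p2).
  rewrite {1}e1 mulrDl {1}e2 /lift_vars !rmorphM /= !mulrDr.
  by rewrite -addrA [_ * (_ * q2)]mulrCA !mulrA.
Qed.

Lemma dehomogenizeX (C : fieldType) (n : nat) (m : 'X_{1..n.+1}) :
  dehomogenize 'X_[m] = 'X_[[multinom m (lift ord0 i) | i < n]] :> {mpoly C[n]}.
Proof.
rewrite /dehomogenize comp_mpolyX big_ord_recl tnth0 expr1n mul1r mpolyXE_id.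
by apply: eq_bigr => i _; rewrite tnthS tnth_mktuple mnmE.
Qed.

Lemma dehomogenize_lift (C : fieldType) (n : nat) (p : {mpoly C[n]}) :
  dehomogenize (p \mPo [tuple 'X_(lift ord0 i) | i < n]) = p.
Proof.
rewrite /dehomogenize comp_mpolyA -[RHS]comp_mpoly_id.
congr (_ \mPo _); apply: eq_from_tnth => i.
by rewrite !tnth_mktuple comp_mpolyXi tnthS tnth_mktuple.
Qed.

(** In a fixed degree the exponent of ['X_ord0] is determined by the others, so distinct monomials
    stay distinct at ['X_ord0 = 1] and no cancellation occurs. Identities between homogeneous
    polynomials of one degree can thus be checked after dehomogenizing. *)
Lemma dehomogenize_dhomog_eq0 (C : fieldType) (n d : nat)
    (p : {mpoly C[n.+1]}) :
  p \is d.-homog -> dehomogenize p = 0 -> p = 0.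
Proof.
move=> p_hom p1_0; apply/mpolyP => m; rewrite mcoeff0.
case: (boolP (m \in msupp p)) => [m_p|/memN_msupp_eq0 //].
pose tail (m' : 'X_{1..n.+1}) := [multinom m' (lift ord0 i) | i < n].
have tail_eq m' : m' \in msupp p -> (tail m' == tail m) = (m' == m).
  move=> m'_p; apply/eqP/eqP => [tail_m'm|-> //].
  have m'i i : m' (lift ord0 i) = m (lift ord0 i).
    by have /mnmP/(_ i) := tail_m'm; rewrite !mnmE.
  apply/mnmP => i; case: (unliftP ord0 i) => [j ->//|->].
  have := dhomog_mf p_hom m'_p; rewrite -(dhomog_mf p_hom m_p) /= !mdegE.
  by rewrite !big_ord_recl (eq_bigr _ (fun i _ => m'i i)) => /addIn.
have p1_E : dehomogenize p = \sum_(m' <- msupp p) p@_m' *: 'X_[tail m'].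
  rewrite {1}(mpolyE p) raddf_sum; apply: eq_bigr => m' _ /=.
  by rewrite linearZ /= dehomogenizeX.
have /mpolyP/(_ (tail m)) := p1_0.
rewrite p1_E mcoeff0 raddf_sum (bigD1_seq m) ?msupp_uniq //= mcoeffZ mcoeffX.
rewrite eqxx mulr1 big_seq_cond big1 ?addr0 // => m' /andP[m'_p ne_m'm].
by rewrite mcoeffZ mcoeffX tail_eq // (negbTE ne_m'm) mulr0.
Qed.

(* Homogeneous of degree N only if deg p <= N: the subtraction truncates. *)
Definition homogenize (C : fieldType) (n N : nat) (p : {mpoly C[n]}) :
    {mpoly C[n.+1]} :=
  \sum_(m <- msupp p)
    p@_m *: ('X_ord0 ^+ (N - mdeg m) *
             ('X_[m] \mPo [tuple 'X_(lift ord0 i) | i < n])).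

(** Valid for every [N], even below the degree of [p], since all powers of ['X_ord0] become 1. *)
Lemma homogenizeK (C : fieldType) (n N : nat) (p : {mpoly C[n]}) :
  dehomogenize (homogenize N p) = p.
Proof.
rewrite [RHS]mpolyE /homogenize raddf_sum; apply: eq_bigr => m _.
rewrite /= linearZ rmorphM /= dehomogenize_lift rmorphXn /=.
by rewrite {1}/dehomogenize comp_mpolyXi tnth0 expr1n mul1r.
Qed.

Lemma homogenize_dhomog (C : fieldType) (n N : nat) (p : {mpoly C[n]}) :
  (msize p <= N.+1)%N -> homogenize N p \is N.-homog.
Proof.
move=> p_le; rewrite /homogenize big_seq; apply: rpred_sum => m m_p.
apply: rpredZ.
have X0_hom := dhomogMn (N - mdeg m) (dhomog_X1 C (ord0 : 'I_n.+1)).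
have Xm_hom : 'X_[m] \mPo [tuple ('X_(lift ord0 i) : {mpoly C[n.+1]}) | i < n]
    \is (mdeg m).-homog.
  apply: comp_dhomog; last by rewrite dhomogX.
  by move=> i; rewrite tnth_mktuple dhomog_X1.
have := dhomogM X0_hom Xm_hom; rewrite mul1n subnK //.
by rewrite -ltnS (leq_trans (msize_mdeg_lt m_p)).
Qed.

(** * Transfer of bases along a semilinear map *)

(* The kernel condition says that N is the base change of M along phi. *)
Lemma free_module_transfer (A B : pzRingType) (V : lmodType A) (W : lmodType B)
    (phi : {rmorphism A -> B}) (section : B -> A) (Phi : V -> W)
    (M : V -> Prop) (N : W -> Prop) :
    cancel section phi ->
    {morph Phi : x y / x + y} ->
    (forall a v, Phi (a *: v) = phi a *: Phi v) ->
    (forall a u v, M u -> M v -> M (a *: u + v)) ->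
    (forall v, M v -> N (Phi v)) ->
    (forall w, N w -> exists2 v, M v & Phi v = w) ->
    (forall v, M v -> Phi v = 0 ->
      exists a u, [/\ phi a = 0, M u & v = a *: u]) ->
  free_module M -> free_module N.
Proof.
move=> sectionK PhiD PhiZ M_lin MN Phi_onto Phi_ker [I [b [Mb b_gen b_free]]].
have Phi0 : Phi 0 = 0 by rewrite -(scale0r 0) PhiZ rmorph0 scale0r.
have Phi_sum (s : seq I) (c : I -> A) :
    Phi (\sum_(i <- s) c i *: b i) = \sum_(i <- s) phi (c i) *: Phi (b i).
  rewrite (big_morph Phi PhiD Phi0); apply: eq_bigr => i _; exact: PhiZ.
exists I, (Phi \o b); split=> [i | w /Phi_onto[v Mv <-] | s c s_uniq].
- exact: MN (Mb i).
- have [s [c [s_uniq ->]]] := b_gen v Mv.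
  by exists s, (phi \o c); split=> //; rewrite Phi_sum.
move=> sum0 i i_s.
(* The relation among the images is lifted coefficientwise; [section] need not be additive for
   this. *)
pose v := \sum_(i <- s) section (c i) *: b i.
have Phi_v0 : Phi v = 0.
  by rewrite Phi_sum -[RHS]sum0; apply: eq_bigr => j _; rewrite sectionK.
have M0 : M 0 by have := M_lin (-1) _ _ (Mb i) (Mb i); rewrite scaleN1r addNr.
have Mv : M v.
  by apply: big_rec => // j u _; apply: M_lin.
have [a [u [phi_a0 Mu v_au]]] := Phi_ker v Mv Phi_v0.
have [t [e [t_uniq u_e]]] := b_gen u Mu.
(* Extension by zero lets [v] and [u], written over different index lists, be compared over one
   duplicate-free list. *)
pose restr (r : seq I) (h : I -> A) j := if j \in r then h j else 0.
have restr_sum (r q : seq I) h : uniq r -> uniq q -> {subset r <= q} ->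
    \sum_(j <- q) restr r h j *: b j = \sum_(j <- r) h j *: b j.
  move=> r_uniq q_uniq r_q; rewrite (bigID [in r]) /= addrC big1 ?add0r.
    rewrite -big_filter (perm_big r).
      rewrite big_seq [RHS]big_seq; apply: eq_bigr => j j_r.
      by rewrite /restr j_r.
    apply: uniq_perm => // [|j]; first exact: filter_uniq.
    by rewrite mem_filter; case: (boolP (j \in r)) => // /r_q ->.
  by move=> j /negbTE j_r; rewrite /restr j_r scale0r.
pose q := undup (s ++ t).
have q_uniq : uniq q by exact: undup_uniq.
(* The equality [v = a *: u] is a relation among the [b j], so each [section (c i)] equals [a] times
   a coefficient of [u]; applying [phi], which kills [a], gives [c i = 0]. *)
have := b_free q (fun j => restr s (section \o c) j - a * restr t e j) q_uniq.
under eq_bigr do rewrite scalerBl -scalerA.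
rewrite sumrB -scaler_sumr !restr_sum //; last 2 first.
- by move=> j j_s; rewrite mem_undup mem_cat j_s.
- by move=> j j_t; rewrite mem_undup mem_cat j_t orbT.
rewrite -u_e -v_au subrr => /(_ erefl i).
rewrite mem_undup mem_cat i_s => /(_ isT) /(congr1 phi).
by rewrite rmorphB rmorphM phi_a0 mul0r subr0 rmorph0 /restr i_s /= sectionK.
Qed.

(** * Syzygies of the gradient under linear coordinate changes *)

(** A column, so that [AR f] is its left kernel and the chain rule becomes a matrix identity. *)
Definition gradient (C : fieldType) (n : nat) (f : {mpoly C[n]}) :
    'cV[{mpoly C[n]}]_n :=
  \col_i f^`M(i).

Lemma AR_gradient (C : fieldType) (n : nat) (f : {mpoly C[n]}) a :
  AR f a <-> a *m gradient f = 0.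
Proof.
have E : (a *m gradient f) 0 0 = \sum_(i < n) a 0 i * f^`M(i).
  by rewrite mxE; apply: eq_bigr => i _; rewrite mxE.
rewrite /AR -E; split=> [a0|-> ]; last by rewrite mxE.
by apply/matrixP => i j; rewrite !ord1 a0 mxE.
Qed.

Lemma AR_linear (C : fieldType) (n : nat) (f : {mpoly C[n]}) a u v :
  AR f u -> AR f v -> AR f (a *: u + v).
Proof.
rewrite !AR_gradient => u0 v0.
by rewrite mulmxDl -scalemxAl u0 v0 scaler0 addr0.
Qed.

Lemma change_coordsM (C : fieldType) (n : nat) (M N : 'M[C]_n) p :
  change_coords N (change_coords M p) = change_coords (M *m N) p.
Proof.
rewrite {1 2}/change_coords comp_mpolyA; congr (_ \mPo _).
apply: eq_from_tnth => i; rewrite !tnth_mktuple raddf_sum /=.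
under eq_bigr do rewrite linearZ /= comp_mpolyXi tnth_mktuple scaler_sumr.
rewrite exchange_big; apply: eq_bigr => k _ /=; rewrite mxE scaler_suml.
by apply: eq_bigr => j _; rewrite scalerA.
Qed.

Lemma change_coords1 (C : fieldType) (n : nat) (p : {mpoly C[n]}) :
  change_coords 1%:M p = p.
Proof.
rewrite -[RHS]comp_mpoly_id; congr (_ \mPo _); apply: eq_from_tnth => i.
rewrite !tnth_mktuple (bigD1 i) //= mxE eqxx scale1r big1 ?addr0 // => j.
by rewrite eq_sym mxE => /negbTE ->; rewrite scale0r.
Qed.

Lemma change_coordsK (C : fieldType) (n : nat) (M : 'M[C]_n) :
  M \in unitmx -> cancel (change_coords M) (change_coords (invmx M)).
Proof. by move=> M_unit p; rewrite change_coordsM mulmxV ?change_coords1. Qed.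

Lemma change_coordsVK (C : fieldType) (n : nat) (M : 'M[C]_n) :
  M \in unitmx -> cancel (change_coords (invmx M)) (change_coords M).
Proof. by move=> M_unit p; rewrite change_coordsM mulVmx ?change_coords1. Qed.

Lemma change_coords_dhomog (C : fieldType) (n d : nat) (M : 'M[C]_n) p :
  p \is d.-homog -> change_coords M p \is d.-homog.
Proof.
apply: comp_dhomog => i; rewrite tnth_mktuple; apply: rpred_sum => j _.
exact/rpredZ/dhomog_X1.
Qed.

Lemma change_coords_reduced (C : fieldType) (n : nat) (M : 'M[C]_n) f :
  M \in unitmx -> reduced f -> reduced (change_coords M f).
Proof.
move=> M_unit f_reduced q [r fM].
rewrite -[q](change_coordsVK M_unit); apply: rmorph_unit; apply: f_reduced.
exists (change_coords (invmx M) r).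
by rewrite -rmorphXn -rmorphM /= -fM change_coordsK.
Qed.

(** The chain rule for [x = M y], whose Jacobian matrix is the constant matrix [M]. *)
Lemma gradient_change_coords (C : fieldType) (n : nat) (M : 'M[C]_n) f :
  gradient (change_coords M f) =
  (map_mx (@mpolyC n C) M)^T *m map_mx (change_coords M) (gradient f).
Proof.
apply/matrixP => j k; rewrite !mxE mderiv_comp; apply: eq_bigr => i _.
rewrite !mxE tnth_mktuple.
have -> : (\sum_(l < n) M i l *: 'X_l)^`M(j) = (M i j)%:MP_[n].
  rewrite raddf_sum (bigD1 j) //= mderivZ mderivXU eqxx big1 => [|l ne_lj].
    by rewrite addr0 -mul_mpolyC mulr1.
  by rewrite mderivZ mderivXU (negbTE ne_lj) scaler0.
by rewrite mulrC.
Qed.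

Lemma change_coords_free (C : fieldType) (n : nat) (M : 'M[C]_n) f :
  M \in unitmx -> free_hypersurface f ->
  free_hypersurface (change_coords M f).
Proof.
move=> M_unit.
pose K := map_mx (@mpolyC n C) M; pose K' := map_mx (@mpolyC n C) (invmx M).
have K'K : K'^T *m K^T = 1%:M.
  by rewrite -trmx_mul -map_mxM mulmxV // map_mx1 trmx1.
have KK' : K^T *m K'^T = 1%:M.
  by rewrite -trmx_mul -map_mxM mulVmx // map_mx1 trmx1.
(* The factor [K'^T] cancels the transposed Jacobian [K^T] in the new gradient, so syzygies go to
   syzygies. *)
pose Phi (v : 'rV[{mpoly C[n]}]_n) := map_mx (change_coords M) v *m K'^T.
apply: (free_module_transfer (change_coordsVK M_unit) (Phi := Phi)).
- by move=> u v; rewrite /Phi map_mxD mulmxDl.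
- by move=> a v; rewrite /Phi map_mxZ scalemxAl.
- by move=> a u v; apply: AR_linear.
- move=> v; rewrite !AR_gradient => v0.
  rewrite gradient_change_coords mulmxA -(mulmxA _ K'^T) K'K mulmx1.
  by rewrite -map_mxM v0 map_mx0.
- move=> w; rewrite AR_gradient gradient_change_coords => w0.
  exists (map_mx (change_coords (invmx M)) (w *m K^T)).
    rewrite AR_gradient -[gradient f](_ : map_mx (change_coords (invmx M))
      (map_mx (change_coords M) (gradient f)) = _).
      by rewrite -map_mxM -mulmxA w0 map_mx0.
    by apply/matrixP => i j; rewrite !mxE change_coordsK.
  have -> : Phi (map_mx (change_coords (invmx M)) (w *m K^T)) =
      w *m K^T *m K'^T.
    congr (_ *m _); apply/matrixP => i j.
    by rewrite [LHS]mxE [X in change_coords M X]mxE change_coordsVK.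
  by rewrite -mulmxA KK' mulmx1.
(* [Phi] is injective, so [v = 0] and trivial witnesses suffice. *)
- move=> v _ Phi_v0; exists 0, 0; rewrite rmorph0 scaler0.
  split=> //; first by apply/AR_gradient; rewrite mul0mx.
  have /matrixP v0 : map_mx (change_coords M) v = 0.
    by rewrite -[LHS]mulmx1 -K'K mulmxA -/(Phi v) Phi_v0 mul0mx.
  apply/matrixP => i j; have := v0 i j; rewrite !mxE => vij0.
  by rewrite -[v i j](change_coordsK M_unit) vij0 rmorph0.
Qed.

(** * Derivatives and Euler's formula on the affine chart *)

Lemma dehomogenize_eq0 (C : fieldType) (n : nat) (p : {mpoly C[n.+1]}) :
  dehomogenize p = 0 -> exists q, p = ('X_ord0 - 1) * q.
Proof. by rewrite -mpolyC1; apply: mpoly_first_factor. Qed.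

Lemma dehomogenizeX0 (C : fieldType) (n : nat) :
  dehomogenize 'X_ord0 = 1 :> {mpoly C[n]}.
Proof. by rewrite /dehomogenize comp_mpolyXi tnth0. Qed.

Lemma dehomogenizeXS (C : fieldType) (n : nat) (i : 'I_n) :
  dehomogenize 'X_(lift ord0 i) = 'X_i :> {mpoly C[n]}.
Proof. by rewrite /dehomogenize comp_mpolyXi tnthS tnth_mktuple. Qed.

Lemma mderiv_dehomogenize (C : fieldType) (n : nat) (p : {mpoly C[n.+1]}) j :
  (dehomogenize p)^`M(j) = dehomogenize p^`M(lift ord0 j).
Proof.
rewrite mderiv_comp big_ord_recl tnth0 -{2}mpolyC1 mderivC mulr0 add0r.
rewrite (bigD1 j) //= big1 => [|i ne_ij].
  by rewrite tnthS tnth_mktuple mderivXU eqxx mulr1 addr0.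
by rewrite tnthS tnth_mktuple mderivXU (negbTE ne_ij) mulr0.
Qed.

Lemma euler_dehomogenize (C : fieldType) (n d : nat) (F : {mpoly C[n.+1]}) :
  F \is d.-homog ->
  dehomogenize F^`M(ord0) + \sum_(j < n) 'X_j * (dehomogenize F)^`M(j) =
  dehomogenize F *+ d.
Proof.
move=> F_hom; rewrite -raddfMn -(euler_dhomog F_hom) big_ord_recl /= rmorphD.
rewrite rmorphM /= dehomogenizeX0 mul1r.
rewrite [dehomogenize (\sum_(i < n) _)]rmorph_sum; congr (_ + _).
apply: eq_bigr => j _.
by rewrite rmorphM /= dehomogenizeXS mderiv_dehomogenize.
Qed.

(** * Reducedness of the affine part *)

(** Setting ['X_ord0] to 0 is a ring morphism into an integral domain, with kernel generated by
    ['X_ord0]. *)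
Lemma X0_prime (C : fieldType) (n : nat) (p q : {mpoly C[n.+1]}) :
  mdivides 'X_ord0 (p * q) -> mdivides 'X_ord0 p \/ mdivides 'X_ord0 q.
Proof.
pose at0 :=
  comp_mpoly (cons_tuple 0%:MP_[n] [tuple ('X_i : {mpoly C[n]}) | i < n]).
have at0_eq0 r : at0 r = 0 -> mdivides 'X_ord0 r.
  by case/mpoly_first_factor => s ->; exists s; rewrite mpolyC0 subr0 mulrC.
case=> r pq; have /eqP : at0 (p * q) = 0.
  by rewrite pq /at0 rmorphM /= comp_mpolyXi tnth0 mpolyC0 mulr0.
by rewrite /at0 rmorphM mulf_eq0 => /orP[] /eqP /at0_eq0; [left | right].
Qed.

(* Each factor 'X_0 can be cancelled against r or, by primality of 'X_0,
   absorbed into q without changing its dehomogenization. *)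
Lemma square_divisor_saturate (C : fieldType) (n a : nat)
    (F r q : {mpoly C[n.+1]}) :
  'X_ord0 ^+ a * F = r * q ^+ 2 ->
  exists2 q', mdivides (q' ^+ 2) F & dehomogenize q' = dehomogenize q.
Proof.
elim/ltn_ind: a r q => -[|a] IHa r q E.
  by exists q => //; exists r; rewrite -E mul1r.
have X_n0 : 'X_ord0 != 0 :> {mpoly C[n.+1]}.
  by rewrite -msize_poly_eq0 mmeasureX.
have : mdivides 'X_ord0 (r * q ^+ 2).
  by exists ('X_ord0 ^+ a * F); rewrite -E exprSr mulrAC.
case/X0_prime => [[r' r_E]|].
  apply: (IHa a _ r' q) => //; apply: (mulfI X_n0).
  by rewrite mulrA -exprS E r_E [r' * 'X_ord0]mulrC -mulrA.
have q_dvd : mdivides 'X_ord0 (q ^+ 2) -> mdivides 'X_ord0 q.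
  by rewrite expr2 => /X0_prime[].
case/q_dvd => q' q_E.
have deh_q : dehomogenize q' = dehomogenize q.
  by rewrite q_E rmorphM /= dehomogenizeX0 mulr1.
(* Taking ['X_ord0] out of [q] frees two factors on the right. If the left has only one, the surplus
   factor joins the cofactor [r]; otherwise both cancel and the induction continues. *)
case: a IHa E => [|a] IHa E; rewrite -deh_q.
  exists q' => //; exists (r * 'X_ord0); apply: (mulfI X_n0).
  transitivity (r * q ^+ 2); first exact: E.
  rewrite q_E exprMn mulrA ['X_ord0 ^+ 2]expr2.
  by rewrite [r * _ * _ in RHS]mulrAC mulrCA.
apply: (IHa a _ r q') => //; apply: (mulfI X_n0); apply: (mulfI X_n0).
transitivity (r * q ^+ 2); first by rewrite -E !exprS !mulrA.
by rewrite q_E exprMn mulrA ['X_ord0 ^+ 2]expr2 [RHS]mulrC -[RHS]mulrA.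
Qed.

(** A square divisor of the dehomogenization homogenizes to one of [F] up to powers of ['X_ord0],
    which saturation removes. *)
Lemma dehomogenize_reduced (C : fieldType) (n d : nat) (F : {mpoly C[n.+1]}) :
  F \is d.-homog -> reduced F -> reduced (dehomogenize F).
Proof.
move=> F_hom F_reduced q [r F_E].
pose Q := homogenize (msize q) q; pose P := homogenize (msize r) r.
(* This is the degree of [P * Q ^+ 2], so both sides below are homogeneous of degree [a + d] and
   agree at ['X_ord0 = 1]. *)
pose a := (msize r + msize q * 2)%N.
have E : 'X_ord0 ^+ a * F = 'X_ord0 ^+ d * P * Q ^+ 2.
  apply/eqP; rewrite -subr_eq0; apply/eqP.
  apply: (@dehomogenize_dhomog_eq0 _ _ (a + d)).
    have X_hom e := dhomogMn e (dhomog_X1 C (ord0 : 'I_n.+1)).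
    apply: rpredB.
      by have := dhomogM (X_hom a) F_hom; rewrite mul1n.
    have P_hom : P \is (msize r).-homog by apply: homogenize_dhomog.
    have Q_hom : Q \is (msize q).-homog by apply: homogenize_dhomog.
    have := dhomogM (dhomogM (X_hom d) P_hom) (dhomogMn 2 Q_hom).
    by rewrite mul1n -addnA addnC.
  rewrite rmorphB !rmorphM !rmorphXn /= dehomogenizeX0 !expr1n !mul1r.
  by rewrite !homogenizeK F_E subrr.
have [Q' Q'_F deh_Q'] := square_divisor_saturate E.
rewrite -[q](homogenizeK (msize q)) -/Q -deh_Q'.
exact/rmorph_unit/F_reduced.
Qed.

(** * Freeness of the affine part *)

Lemma reduced_neq0 (C : fieldType) (n : nat) (f : {mpoly C[n]}) :
  reduced f -> f != 0.
Proof.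
move=> f_reduced; apply/eqP => f0.
have /f_reduced : mdivides (0 ^+ 2) f by exists 0; rewrite mul0r.
by rewrite unitr0.
Qed.

(** Since [d] is invertible in [C], Euler's formula determines the zeroth entry of a syzygy from the
    cofactor of its derivation. *)
Lemma dehomogenize_free (C : fieldType) (n d : nat) (F : {mpoly C[n.+1]}) :
  d%:R != 0 :> C -> F \is d.-homog -> F != 0 ->
  free_hypersurface F -> free_module (Der (dehomogenize F)).
Proof.
move=> d_n0 F_hom F_n0; set g := dehomogenize F.
have g_n0 : g != 0.
  by apply: contra_neq F_n0; apply: dehomogenize_dhomog_eq0 F_hom.
have mulrn_d (p : {mpoly C[n]}) : p *+ d = d%:R *: p by rewrite scaler_nat.
have F0_E := euler_dehomogenize F_hom.
(* On ['X_ord0 = 1], subtracting [v 0 ord0] times the Euler field removes the component along the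
   first variable. *)
pose Phi (v : 'rV[{mpoly C[n.+1]}]_n.+1) : 'rV[{mpoly C[n]}]_n :=
  \row_j (dehomogenize (v 0 (lift ord0 j)) - dehomogenize (v 0 ord0) * 'X_j).
have Phi_gradient v : AR F v ->
    \sum_j Phi v 0 j * g^`M(j) = - (dehomogenize (v 0 ord0) *+ d) * g.
  move=> v_AR.
  have := congr1 (@dehomogenize C n) v_AR.
  rewrite rmorph_sum rmorph0 big_ord_recl /= rmorphM /= => /eqP.
  rewrite addr_eq0 => /eqP v_E.
  transitivity (\sum_j dehomogenize (v 0 (lift ord0 j)) * g^`M(j) -
                dehomogenize (v 0 ord0) * \sum_j 'X_j * g^`M(j)).
    rewrite mulr_sumr -sumrB; apply: eq_bigr => j _.
    by rewrite mxE mulrBl mulrA.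
  under eq_bigr do rewrite mderiv_dehomogenize -rmorphM.
  rewrite -[X in X - _]opprK -v_E -opprD -mulrDr F0_E.
  by rewrite mulrnAr mulNr mulrnAl.
apply: (free_module_transfer (@dehomogenize_lift C n) (Phi := Phi)).
- move=> u v; apply/rowP => j; rewrite !mxE !raddfD /= mulrDl.
  by rewrite addrACA opprD.
- move=> a v; apply/rowP => j; rewrite !mxE !rmorphM /= mulrBr.
  by rewrite mulrA.
- by move=> a u v; apply: AR_linear.
- by move=> v /Phi_gradient v_E; exists (- (dehomogenize (v 0 ord0) *+ d)).
- move=> w [h w_E].
  (* By [Phi_gradient] the cofactor [h] must be [-d] times the zeroth entry, which forces [b0]; the
     other entries of [b] then invert [Phi]. *)
  pose b0 := - (d%:R^-1 *: h).
  pose b i := if unlift ord0 i is Some j then w 0 j + b0 * 'X_j else b0.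
  (* One common degree for all entries makes the syzygy sum homogeneous, so its vanishing can be
     tested at ['X_ord0 = 1]. *)
  pose N := \max_i msize (b i).
  have b_le i : (msize (b i) <= N.+1)%N by rewrite leqW // leq_bigmax.
  exists (\row_i homogenize N (b i)); last first.
    apply/rowP => j; rewrite !mxE !homogenizeK /b liftK unlift_none.
    by rewrite addrK.
  rewrite /AR; under eq_bigr do rewrite mxE.
  apply: (@dehomogenize_dhomog_eq0 _ _ (N + d.-1)).
    apply: rpred_sum => i _; apply: dhomogM; first exact: homogenize_dhomog.
    exact: mderiv_dhomog.
  rewrite rmorph_sum big_ord_recl /= rmorphM /= homogenizeK /b unlift_none.
  under eq_bigr do rewrite rmorphM /= homogenizeK liftK -mderiv_dehomogenize
    mulrDl -mulrA.
  rewrite big_split /= -mulr_sumr w_E addrCA -mulrDr F0_E mulrn_d.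
  rewrite /b0 mulNr -scalerAl -scalerAr scalerA mulVf // scale1r.
  by rewrite subrr.
- move=> v v_AR Phi_v0.
  (* The zero derivation has cofactor 0, because [g] is nonzero in a domain. With this entry zero at
     ['X_ord0 = 1], [Phi v = 0] forces the others to vanish there too. *)
  have v0_0 : dehomogenize (v 0 ord0) = 0.
    have := Phi_gradient v v_AR; rewrite Phi_v0 big1 => [|j _]; last first.
      by rewrite mxE mul0r.
    move/esym/eqP; rewrite mulf_eq0 (negbTE g_n0) orbF oppr_eq0 mulrn_d.
    by rewrite scaler_eq0 (negbTE d_n0) => /eqP.
  have /fin_all_exists[q q_E] i : exists q, v 0 i = ('X_ord0 - 1) * q.
    apply: dehomogenize_eq0; case: (unliftP ord0 i) => [j ->|-> //].
    have /rowP/(_ j) := Phi_v0.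
    by rewrite !mxE v0_0 mul0r subr0.
  exists ('X_ord0 - 1), (\row_i q i); split.
  + by rewrite rmorphB rmorph1 /= dehomogenizeX0 subrr.
  + have X1_n0 : 'X_ord0 - 1 != 0 :> {mpoly C[n.+1]}.
      apply/eqP => /(congr1 (mcoeff U_(ord0))).
      rewrite mcoeffB mcoeffXU eqxx mcoeff1 mnm1_eq0 subr0 mcoeff0.
      by move/eqP; rewrite oner_eq0.
    (* The quotient by ['X_ord0 - 1] is still a syzygy: the nonzero factor cancels from the relation
       for [v]. *)
    apply: (mulfI X1_n0); rewrite mulr0 -[RHS]v_AR mulr_sumr.
    by apply: eq_bigr => i _; rewrite mxE mulrA -q_E.
  + by apply/rowP => i; rewrite !mxE q_E.
Qed.

Theorem corollary3p7 (R : realType) (n d : nat)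
    (f : {mpoly R[i][n.+1]})
    (f_homog : f \is d.-homog) (d_gt1 : (1 < d)%N)
    (f_reduced : reduced f) (f_free : free_hypersurface f)
    (l : {mpoly R[i][n.+1]}) (l_neq0 : l != 0) (l_linear : l \is 1.-homog)
    (l_not_component : ~ irreducible_component f l)
    (M : 'M[R[i]]_n.+1) (M_adapted : adapted_coords l M) :
  A_free (dehomogenize (change_coords M f)).
Proof.
have [M_unit _] := M_adapted.
have fM_homog := change_coords_dhomog M f_homog.
have fM_reduced := change_coords_reduced M_unit f_reduced.
split; first exact: dehomogenize_reduced fM_homog fM_reduced.
apply: dehomogenize_free fM_homog (reduced_neq0 fM_reduced) _.
  (* Characteristic zero makes the degree nonzero in [R[i]]. *)
  by rewrite pnatr_eq0 -lt0n ltnW.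
exact: change_coords_free.
Qed.
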